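(* Let $k \geq 1$ be an integer, $n$ an odd positive integer, and $p = 2^k n + 1$ a prime. Then there is a polynomial $f_k(x) \in \mathbf{F}_p[x]$ which is a polynomial representation of the square root function modulo $p$ (i.e. $f_k(x)^2 \equiv x \pmod p$ for every quadratic residue $x$ modulo $p$), of degree $\deg(f_k) = 2^{k-1}n - (n-1)/2$, with $2^{k-1}$ terms, and of the form $$f_k(x) = 2^{-(k-1)} x^{(n+1)/2}\left[c_{2^{k-1}-1} x^{(2^{k-1}-1)n} + c_{2^{k-1}-2} x^{(2^{k-1}-2)n} + \dots + c_2 x^{2n} + c_1 x^n + c_0\right]$$ for some coefficients $c_0, \dots, c_{2^{k-1}-1} \in \mathbf{F}_p$.
   Context: A polynomial $f(x) \in \mathbf{F}_p[x]$ is called a polynomial representation of the square root function mod $p$ if $\sqrt{x} \equiv \pm f(x) \pmod p$, i.e. $f(x)^2 \equiv x \pmod p$, whenever $x$ is a (nonzero) quadratic residue modulo $p$. The number of terms of a polynomial is its number of nonzero monomials. *)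

(* Defs.v *)
From mathcomp Require Import all_boot all_order all_algebra.

Set Implicit Arguments.
Unset Strict Implicit.
Unset Printing Implicit Defensive.

Import GRing.Theory.
Local Open Scope ring_scope.

(* Only meaningful for p prime: 'F_p is then the field Z/pZ. *)
Definition quadratic_residue (p : nat) (x : 'F_p) : Prop :=
  x != 0 /\ exists y : 'F_p, x = y ^+ 2.

Definition sqrt_representation (p : nat) (f : {poly 'F_p}) : Prop :=
  forall x : 'F_p, quadratic_residue x -> f.[x] ^+ 2 = x.

Definition nterms (R : nzRingType) (f : {poly R}) : nat :=
  #|[set i : 'I_(size f) | f`_i != 0]|.

(* Main.v *)
Require Import Defs.
From mathcomp Require Import all_boot all_order all_algebra.
From mathcomp Require Import cyclic finfield.
From mathcomp Require Import zify.

Set Implicit Arguments.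
Unset Strict Implicit.
Unset Printing Implicit Defensive.

Import GRing.Theory.
Local Open Scope ring_scope.

(** Put N = 2^(k-1). For a quadratic residue x, u = x^n is an N-th root of
    unity, and f(x) = x^((n+1)/2) g(x^n) squares to x as soon as
    u g(u)^2 = 1. Fix a primitive 2N-th root of unity z. Every such u is
    z^(-2m) for exactly one m < N, and we let g interpolate the values
    g(z^(-2m)) = z^m. By Fourier inversion its i-th coefficient is 1/N times
    the geometric sum of the z^(j(2i+1)), j < N, which is
    2 / (1 - z^(2i+1)) since z^N = -1; hence no coefficient vanishes. *)

Section RootsOfUnity.

Variable F : fieldType.

Lemma geometric_sum_unity_root (N : nat) (w : F) :
  w ^+ N = 1 -> \sum_(i < N) w ^+ i = if w == 1 then N%:R else 0.
Proof.
move=> wN; case: eqP => [->|/eqP w1].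
  under eq_bigr do rewrite expr1n.
  by rewrite sumr_const card_ord.
apply: (mulfI (x := w - 1)); first by rewrite subr_eq0.
by rewrite -subrX1 wN subrr mulr0.
Qed.

(** The square of [z ^+ N] is 1, and [z ^+ N = 1] would make [2 * N] divide [N]. *)
Lemma prim_root_double_half (N : nat) (z : F) :
  (0 < N)%N -> (2 * N).-primitive_root z -> z ^+ N = -1.
Proof.
move=> N0 pz; have /eqP := prim_expr_order pz.
rewrite mulnC exprM sqrf_eq1 => /orP[|/eqP//].
rewrite -(prim_order_dvd pz) => /dvdn_leq; lia.
Qed.

(** This is [N] times the i-th interpolation coefficient; the factor 1/N is kept apart, as it
    becomes the scalar 2^-(k-1) of the theorem. *)
Definition half_geometric_sum (z : F) (N i : nat) : F :=
  \sum_(j < N) (z ^+ i.*2.+1) ^+ j.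

(** With w = z^(2i+1), the sum times w - 1 is w^N - 1 = (-1)^(2i+1) - 1 = -2, so a zero sum would
    force 2 = 0. *)
Lemma half_geometric_sum_neq0 (z : F) (N i : nat) :
  2%:R != 0 :> F -> (0 < N)%N -> (2 * N).-primitive_root z ->
  half_geometric_sum z N i != 0.
Proof.
move=> two0 N0 pz; apply/eqP => s0.
have := subrX1 (z ^+ i.*2.+1) N; rewrite -/(half_geometric_sum z N i) s0 mulr0.
rewrite -exprM mulnC exprM (prim_root_double_half N0 pz) exprS -muln2 mulnC.
rewrite exprM sqrrN !expr1n mulr1 -opprD => /eqP.
by rewrite oppr_eq0 -mulr2n (negbTE two0).
Qed.

Lemma half_geometric_sum_interpolates (z u : F) (N : nat) :
  (0 < N)%N -> (2 * N).-primitive_root z -> u ^+ N = 1 ->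
  (\sum_(i < N) half_geometric_sum z N i * u ^+ i) ^+ 2 * u = N%:R ^+ 2.
Proof.
move=> N0 pz uN.
have pz2 : N.-primitive_root (z ^+ 2).
  have := dvdn_prim_root pz (dvdn_mull 2 (dvdnn N)).
  by rewrite mulnK.
have z2N := prim_expr_order pz2.
have u0 : u != 0.
  apply/eqP => u0; move: uN; rewrite u0 expr0n gtn_eqF // => /esym/eqP.
  by rewrite oner_eq0.
(* This [m] gives a square root z^m of u^-1, the value that the sum must take at [u] up to the
   factor [N]. *)
have [m um] := prim_rootP pz2 (x := u^-1) ltac:(by rewrite exprVn uN invr1).
suff -> : \sum_(i < N) half_geometric_sum z N i * u ^+ i = z ^+ m * N%:R.
  by rewrite exprMn -exprM mulnC exprM -um mulrAC mulVf // mul1r.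
(* Regroup z^(j(2i+1)) u^i as z^j (z^(2j) u)^i. The inner sum over i vanishes unless z^(2j) = u^-1,
   which singles out j = m. *)
transitivity (\sum_(j < N) z ^+ j * \sum_(i < N) ((z ^+ 2) ^+ j * u) ^+ i).
  under eq_bigr do rewrite /half_geometric_sum mulr_suml.
  rewrite exchange_big; apply: eq_bigr => j _; rewrite mulr_sumr.
  apply: eq_bigr => i _ /=.
  rewrite exprMn mulrA -!exprM -exprD; congr (z ^+ _ * _); lia.
rewrite (bigD1 m) //= -um mulVf // geometric_sum_unity_root ?expr1n // eqxx.
rewrite big1 ?addr0 // => j jm.
rewrite geometric_sum_unity_root; last first.
  by rewrite exprMn uN mulr1 (exprAC _ j) z2N expr1n.
case: eqP => [zju|_]; last by rewrite mulr0.
have /eqP : (z ^+ 2) ^+ j = (z ^+ 2) ^+ m.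
  by rewrite -um -[LHS](mulfK u0) zju mul1r.
by rewrite (eq_prim_root_expr pz2) !modn_small // (inj_eq val_inj) (negbTE jm).
Qed.

End RootsOfUnity.

Section SparsePolynomials.

Variables (R : nzRingType) (N : nat) (a : 'I_N -> R) (e : 'I_N -> nat).
Hypotheses (a_neq0 : forall i, a i != 0) (e_inj : injective e).

Let f : {poly R} := \sum_i a i *: 'X^(e i).

Lemma coef_sparse (i : 'I_N) : f`_(e i) = a i.
Proof.
rewrite coef_sum (bigD1 i) //= coefZ coefXn eqxx mulr1 big1 ?addr0 // => j ji.
by rewrite coefZ coefXn (inj_eq e_inj) eq_sym (negbTE ji) mulr0.
Qed.

Lemma coef_sparse_support (m : nat) : f`_m != 0 -> exists i, m = e i.
Proof.
move=> fm; apply/'exists_eqP; apply: contraR fm => /existsPn me.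
rewrite coef_sum big1 // => i _.
by rewrite coefZ coefXn (negbTE (me i)) mulr0.
Qed.

Lemma size_sparse_gt (i : 'I_N) : (e i < size f)%N.
Proof.
rewrite ltnNge; apply/negP => /(nth_default 0) fe.
by have := a_neq0 i; rewrite -coef_sparse fe eqxx.
Qed.

(** The map [e] is a bijection from the indices onto the support of [f]. *)
Lemma nterms_sparse : nterms f = N.
Proof.
rewrite /nterms; pose g i : 'I_(size f) := Ordinal (size_sparse_gt i).
have -> : [set i : 'I_(size f) | f`_i != 0] = [set g i | i : 'I_N].
  apply/setP => m; rewrite inE; apply/idP/imsetP => [|[i _ ->]].
    by case/coef_sparse_support => i mi; exists i => //; apply: val_inj.
  by rewrite coef_sparse.
by rewrite card_imset ?card_ord // => i j /(congr1 val) /= /e_inj.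
Qed.

Lemma size_sparse (top : 'I_N) :
  (forall i, e i <= e top)%N -> size f = (e top).+1.
Proof.
move=> le_top; apply/eqP; rewrite eqn_leq size_sparse_gt andbT.
apply/leq_sizeP => m lt_m; apply/eqP; apply: contraTT lt_m.
by case/coef_sparse_support => i ->; rewrite -leqNgt.
Qed.

End SparsePolynomials.

Lemma Fp_expf_pred (p : nat) (x : 'F_p) : prime p -> x != 0 -> x ^+ p.-1 = 1.
Proof.
move=> pp x0; apply: (mulfI x0).
have := expf_card x; rewrite card_Fp // => xp.
by rewrite -exprS prednK ?prime_gt0 // xp mulr1.
Qed.

(** The p - 1 nonzero elements are distinct (p-1)-th roots of unity, and that many of them in a
    field include a primitive one. *)
Lemma Fp_prim_root (p : nat) :
  prime p -> exists z : 'F_p, p.-1.-primitive_root z.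
Proof.
move=> pp; have p1 := prime_gt1 pp.
have : has p.-1.-primitive_root (enum (predC1 (0 : 'F_p))).
  apply: has_prim_root; first lia.
  - apply/allP => x; rewrite mem_enum => x0.
    by rewrite unity_rootE Fp_expf_pred.
  - exact: enum_uniq.
  - by rewrite -cardE cardC1 card_Fp.
by case/hasP => z _ pz; exists z.
Qed.

Theorem theorem6 (k n p : nat) (hk : (1 <= k)%N) (hn : odd n)
    (hp : p = (2 ^ k * n + 1)%N) (p_prime : prime p) :
  exists f : {poly 'F_p},
    [/\ sqrt_representation f,
        size f = (2 ^ (k - 1) * n - (n - 1) %/ 2).+1,
        nterms f = (2 ^ (k - 1))%N
      & exists c : 'I_(2 ^ (k - 1)) -> 'F_p,
          f = (2%:R ^- (k - 1)) *:
              ('X^((n + 1) %/ 2)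
                 * \sum_(i < 2 ^ (k - 1)) c i *: 'X^(i * n))].
Proof.
have n0 : (0 < n)%N by case: n hn {hp}.
have h2 : ((n + 1) %/ 2 * 2 = n + 1)%N by rewrite divnK // dvdn2 oddD hn.
have hm2 : (n - 1 = ((n + 1) %/ 2 - 1) * 2)%N by lia.
have ek : (2 ^ k = 2 * 2 ^ (k - 1))%N by rewrite -expnS subn1 prednK.
have p_pred : (p.-1 = 2 * 2 ^ (k - 1) * n)%N by rewrite hp ek; lia.
have two0 : 2%:R != 0 :> 'F_p.
  rewrite -(dvdn_pcharf (pchar_Fp p_prime)) dvdn_prime2 //.
  (* p - 1 is even, so p cannot be 2. *)
  by apply/eqP => p2; move: p_pred; rewrite -mulnA; lia.
have N0 : (0 < 2 ^ (k - 1))%N by rewrite expn_gt0.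
rewrite -natrX.
have NR0 : (2 ^ (k - 1))%:R != 0 :> 'F_p by rewrite natrX expf_neq0.
set N := (2 ^ (k - 1))%N in p_pred N0 NR0 *.
set h := ((n + 1) %/ 2)%N in h2 hm2 *.
rewrite hm2 mulnK //.
(* The n-th power of a primitive (p-1)-th root has order (p-1)/n = 2N. *)
have [z pz] : exists z : 'F_p, (2 * N).-primitive_root z.
  have [w pw] := Fp_prim_root p_prime; exists (w ^+ n).
  have := dvdn_prim_root pw (m := (2 * N)%N).
  by rewrite p_pred dvdn_mulr // mulKn ?muln_gt0 //; apply.
pose c (i : 'I_N) := half_geometric_sum z N i.
pose f := N%:R^-1 *: ('X^h * \sum_(i < N) c i *: 'X^(i * n)) : {poly 'F_p}.
have fE : f = \sum_(i < N) (N%:R^-1 * c i) *: 'X^(h + i * n).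
  rewrite /f mulr_sumr scaler_sumr; apply: eq_bigr => i _.
  by rewrite -scalerAr scalerA exprD.
have a0 (i : 'I_N) : N%:R^-1 * c i != 0.
  by rewrite mulf_neq0 ?invr_eq0 ?half_geometric_sum_neq0.
have e_inj : injective (fun i : 'I_N => h + i * n)%N.
  by move=> i j /addnI/eqP; rewrite eqn_pmul2r // => /eqP/val_inj.
exists f; split; last by exists c.
- move=> x [x0 [y xy]].
  (* Since x = y^2, this power is y^(2Nn) = y^(p-1). *)
  have xN : (x ^+ n) ^+ N = 1.
    have y0 : y != 0 by apply: contraNneq x0 => y0; rewrite xy y0 expr0n.
    by rewrite xy -!exprM [(n * N)%N]mulnC mulnA -p_pred Fp_expf_pred.
  rewrite /f hornerZ hornerM hornerXn horner_sum.
  under eq_bigr do rewrite hornerZ hornerXn mulnC exprM.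
  have := half_geometric_sum_interpolates N0 pz xN.
  rewrite -/c; set S := \sum_(i < N) _ => SE.
  (* As 2h = n + 1, f(x)^2 = N^-2 x^(n+1) S^2 = x N^-2 (S^2 x^n), where [SE] evaluates the last
     factor to N^2. *)
  rewrite !exprMn -exprM h2 exprD expr1 exprVn.
  rewrite -[x ^+ n * x]mulrC -mulrA [x ^+ n * _]mulrC SE mulrCA mulVf ?mulr1 //.
  by rewrite expf_neq0.
- have topP : (N.-1 < N)%N by rewrite prednK.
  rewrite fE (size_sparse a0 e_inj (top := Ordinal topP)) /=; last first.
    by move=> i; rewrite leq_add2l leq_pmul2r // -ltnS prednK.
  (* The top exponent is h + (N-1)n = Nn - (h-1), because n = 2h - 1. *)
  by congr _.+1; case: (N) N0 => // M _ /=; rewrite mulSn; lia.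
- by rewrite fE nterms_sparse.
Qed.
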